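(* Consider the statistical manifold of Laplace distributions, with probability density functions $$p(x;\mu,\sigma)=\frac{1}{2\sigma}\exp\left(-\frac{|x-\mu|}{\sigma}\right),\qquad x\in\mathbb{R},$$ parametrised by $(\mu,\sigma)\in\mathbb{R}\times(0,\infty)$. Its Fisher matrix is $$G(\mu,\sigma)=\begin{pmatrix}\frac{1}{\sigma^2}&0\\0&\frac{1}{\sigma^2}\end{pmatrix},$$ and for all $(\mu_1,\sigma_1),(\mu_2,\sigma_2)\in\mathbb{R}\times(0,\infty)$ the Fisher--Rao distance is $$d_{\mathrm{FR}}\big((\mu_1,\sigma_1),(\mu_2,\sigma_2)\big)=2\,\mathrm{arctanh}\left(\sqrt{\frac{(\mu_1-\mu_2)^2+(\sigma_1-\sigma_2)^2}{(\mu_1-\mu_2)^2+(\sigma_1+\sigma_2)^2}}\right).$$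
   Context: For a parametric family $p_\xi=p(x;\xi)$ of probability densities with respect to Lebesgue measure, parametrised by $\xi$ in an open set $\Xi\subseteq\mathbb{R}^d$, the Fisher matrix is $G(\xi)=[g_{ij}(\xi)]$ with $g_{ij}(\xi)=\mathbb{E}_{p_\xi}\left[\frac{\partial\log p_\xi}{\partial\xi^i}\frac{\partial\log p_\xi}{\partial\xi^j}\right]$, where for each $\xi$ the partial derivatives are taken at almost every $x$ (for the Laplace family they exist for all $x\neq\mu$). The Fisher--Rao distance $d_{\mathrm{FR}}(\xi_1,\xi_2)$ is the infimum of the lengths $\int_0^1\sqrt{\dot\xi(t)^{\mathsf T}G(\xi(t))\dot\xi(t)}\,\mathrm{d}t$ over piecewise differentiable curves $\xi:[0,1]\to\Xi$ with $\xi(0)=\xi_1$, $\xi(1)=\xi_2$. *)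

(* Defs.v *)
From mathcomp Require Import all_boot all_order all_algebra.
From mathcomp Require Import all_classical all_reals all_analysis.
From mathcomp Require Import ring lra.

Set Implicit Arguments.
Unset Strict Implicit.
Unset Printing Implicit Defensive.

Import Order.TTheory GRing.Theory Num.Theory.
Import numFieldNormedType.Exports.

Local Open Scope classical_set_scope.
Local Open Scope ring_scope.

(* A parametric family of densities on R is a function p with p xi x the value
   at x of the density of parameter xi; the parameters xi are row vectors. *)

Section Densities.
Context {R : realType}.

Definition is_density (f : R -> R) : Prop :=
  [/\ measurable_fun [set: R] f,
      forall x, 0 <= f x &
      (\int[lebesgue_measure]_x (f x)%:E = 1)%E].

(* Expectation of h under the law of density f. *)
Definition expectation_under (f h : R -> R) : R :=
  \int[lebesgue_measure]_x (h x * f x).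

End Densities.

Section Fisher.
Context {R : realType} {d : nat}.
Variable p : 'rV[R]_d -> R -> R.

(* Partial derivative of log p(x; xi) with respect to the i-th parameter. *)
Definition score (xi : 'rV[R]_d) (i : 'I_d) (x : R) : R :=
  derive (fun eta : 'rV[R]_d => ln (p eta x)) xi (delta_mx 0 i : 'rV[R]_d).

Definition fisher_matrix (xi : 'rV[R]_d) : 'M[R]_d :=
  \matrix_(i, j) expectation_under (p xi) (fun x => score xi i x * score xi j x).

(* derive and the real-valued integral are total functions; this says that
   fisher_matrix p xi involves no default value. *)
Definition fisher_matrix_exists (xi : 'rV[R]_d) : Prop :=
  {ae lebesgue_measure, forall x : R, forall i : 'I_d,
      derivable (fun eta : 'rV[R]_d => ln (p eta x)) xi
                (delta_mx 0 i : 'rV[R]_d)} /\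
  (forall i j : 'I_d,
      lebesgue_measure.-integrable [set: R]
        (fun x => (score xi i x * score xi j x * p xi x)%:E)).

End Fisher.

Section FisherRao.
Context {R : realType} {d : nat}.

(* Differentiability of the restriction of f to [a, b] (one-sided at a, b). *)
Definition differentiable_on_itv (a b : R) (f : R -> 'rV[R]_d) : Prop :=
  forall t, t \in `[a, b] ->
    cvg ((fun s : R => (s - t)^-1 *: (f s - f t))
           @ within (`[a, b]%classic `\ t) (nbhs t)).

Definition piecewise_differentiable (a b : R) (f : R -> 'rV[R]_d) : Prop :=
  {within `[a, b]%classic, continuous f} /\
  exists s : seq R, itv_partition a b s /\
    forall i, (i < size s)%N ->
      differentiable_on_itv (nth b (a :: s) i) (nth b (a :: s) i.+1) f.

(* Curves are functions on R of which only the values on [0, 1] matter. *)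
Definition admissible_curve (Xi : set 'rV[R]_d) (xi1 xi2 : 'rV[R]_d)
    (c : R -> 'rV[R]_d) : Prop :=
  [/\ piecewise_differentiable 0 1 c,
      forall t, t \in `[0, 1] -> Xi (c t),
      c 0 = xi1 &
      c 1 = xi2].

(* The integral is a Lebesgue integral with values in [0, +oo]; the velocity
   may fail to exist only at the finitely many points of a partition. *)
Definition fisher_length (p : 'rV[R]_d -> R -> R) (c : R -> 'rV[R]_d) : \bar R :=
  (\int[lebesgue_measure]_(t in `[0%R, 1%R])
     (Num.sqrt ((derive1 c t *m fisher_matrix p (c t) *m (derive1 c t)^T) 0 0))%:E)%E.

Definition fisher_rao_distance (p : 'rV[R]_d -> R -> R) (Xi : set 'rV[R]_d)
    (xi1 xi2 : 'rV[R]_d) : \bar R :=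
  ereal_inf [set fisher_length p c | c in admissible_curve Xi xi1 xi2].

End FisherRao.

Section Laplace.
Context {R : realType}.

Definition laplace_param (mu sigma : R) : 'rV[R]_2 :=
  \row_(i < 2) [:: mu; sigma]`_i.

Definition laplace_pdf (xi : 'rV[R]_2) (x : R) : R :=
  let mu := xi 0 0 in let sigma := xi 0 1 in
  1 / (2 * sigma) * expR (- (`|x - mu| / sigma)).

(* The upper half-plane: sigma > 0. *)
Definition laplace_domain : set 'rV[R]_2 := [set xi | 0 < xi 0 1].

End Laplace.

Section Arctanh.
Context {R : realType}.

Definition arctanh (x : R) : R := ln ((1 + x) / (1 - x)) / 2.

Definition tanh (y : R) : R := (expR y - expR (- y)) / (expR y + expR (- y)).

Lemma tanhK (y : R) : arctanh (tanh y) = y.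
Proof.
rewrite /arctanh /tanh.
have -> : (1 + (expR y - expR (- y)) / (expR y + expR (- y))) /
          (1 - (expR y - expR (- y)) / (expR y + expR (- y)))
        = expR y / expR (- y).
  move: (expR y) (expR (- y)) (expR_gt0 y) (expR_gt0 (- y)) => e n e0 n0.
  by field; apply/and3P; split; apply/eqP; lra.
by rewrite -expRN -expRD opprK expRK -mulr2n -[y *+ 2]mulr_natr mulfK ?pnatr_eq0.
Qed.

End Arctanh.

(* Main.v *)
Require Import Defs.
From mathcomp Require Import all_boot all_order all_algebra.
From mathcomp Require Import all_classical all_reals all_analysis.
From mathcomp Require Import measurable_realfun ring lra.

Import Order.TTheory GRing.Theory Num.Theory.
Import numFieldNormedType.Exports.

Local Open Scope classical_set_scope.
Local Open Scope ring_scope.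

(**
With y = |x - mu| / sigma the scores are sgn(x - mu) / sigma (for x <> mu) and
(y - 1) / sigma, so the entries of the Fisher matrix are moments of e^(-y) on
the half-line, computed from explicit antiderivatives; the off-diagonal ones
vanish by symmetry around mu.

The Fisher metric is thus the metric of the upper half-plane. Two points lie on
a geodesic, a vertical line or a semicircle with ends A < B on the real axis.
Parametrised by arc length s it gives curves of length |s2 - s1|. Conversely the
function Phi, equal to ln sigma on a vertical line and to ln(|z - A| / |z - B|)
for a semicircle, has gradient of norm at most 1 and satisfies Phi = s along the
geodesic, so no admissible curve is shorter. As admissible curves are only
differentiable, with a possibly non-integrable derivative, this last step rests
on the inequality |psi(b) - psi(a)| <= int |psi'| for everywhere differentiable
psi, proved by covering the level layers of |psi'| by open sets.
*)

(** * Increments of differentiable functions *)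

(** The layers [E k], where [h] lies between [k e] and [(k + 1) e], partition the interval, and
    outer regularity encloses each in an open [U k]. Rounding [h] up to [(k + 1) e] costs at most
    [e * (b - a)], and the excess of the open sets at most [e]. *)
Lemma layer_cover (R : realType) (a b : R) (h : R -> R) (e : R) :
  a < b -> 0 < e -> measurable_fun `]a, b[ h ->
  (forall x, x \in `]a, b[ -> 0 <= h x) ->
  exists U : nat -> set R,
    [/\ forall k, open (U k),
        forall x, x \in `]a, b[ -> exists2 k, U k x & h x < k.+1%:R * e &
        (\sum_(k <oo) ((k.+1%:R * e)%:E * lebesgue_measure (U k))
         <= \int[lebesgue_measure]_(x in `]a, b[) (h x)%:E
            + (e * (b - a) + e)%:E)%E].
Proof.
move=> ab e0 mh h0.
pose mu := @lebesgue_measure R; rewrite -/mu.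
pose E k := `]a, b[%classic `&` h @^-1` `[k%:R * e, k.+1%:R * e[%classic.
have mE k : measurable (E k) by apply: mh; exact: measurable_itv.
have cE : \bigcup_k E k = `]a, b[%classic.
  apply/seteqP; split=> [x [k _ []]//|x /= xab].
  exists (Num.truncn (h x / e)) => //; split => //=.
  have h0x : 0 <= h x / e by rewrite divr_ge0 ?h0 ?ltW.
  rewrite in_itv /= -ler_pdivlMr// -ltr_pdivrMr//.
  exact: truncn_itv.
have tE : trivIset setT E.
  apply/trivIsetP => i j _ _ /negP ij; apply/seteqP; split => // x [[_ /= +] [_ /=]].
  rewrite !in_itv /= -!ler_pdivlMr// -!ltr_pdivrMr// => ti tj; apply: ij; apply/eqP.
  have h0x : 0 <= h x / e by apply: le_trans (proj1 (andP ti)).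
  by rewrite -(truncn_def ti) -(truncn_def tj).
have muE k : (mu (E k) <= (b - a)%:E)%E.
  have -> : (b - a)%:E = mu `]a, b[%classic.
    by rewrite /mu lebesgue_measure_itv /= lte_fin ab.
  by apply: le_measure => [||x []//]; rewrite inE; [exact: mE|exact: measurable_itv].
(* The allowed excess of [U k] over [E k]: multiplied by the weight [(k + 1) e] it becomes
   [e / 2 ^ (k + 1)], and these sum to [e]. *)
pose d k := (2 ^ k.+1)%:R^-1 / k.+1%:R : R.
have d0 k : 0 < d k by rewrite divr_gt0 ?invr_gt0 ?ltr0n ?expn_gt0.
have HU k : exists V, [/\ open V, E k `<=` V & (mu (V `\` E k) < (d k)%:E)%E].
  by apply: lebesgue_regularity_outer => //; rewrite (le_lt_trans (muE k))// ltry.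
have /choice[U UP] := HU.
exists U; split.
- by move=> k; have [] := UP k.
- move=> x xab.
  have : (\bigcup_k E k) x by rewrite cE.
  move=> [k _ Ekx]; exists k; first by have [_ + _] := UP k; exact.
  by case: Ekx => _ /=; rewrite in_itv /= => /andP[].
have mU k : measurable (U k) by apply: open_measurable; have [] := UP k.
(* The weight is split as [k e + e]: the part [k e] gives a lower sum for the integral of [h], the
   part [e] gives [e] times the total measure of the layers. *)
apply: (@le_trans _ _ (\sum_(k <oo) (((k%:R * e)%:E * mu (E k) + e%:E * mu (E k)) +
    (e / (2 ^ k.+1)%:R)%:E))%E).
  apply: lee_nneseries => [i _ _|k _].
    by rewrite mule_ge0// lee_fin mulr_ge0// ltW.
  have [_ EU muUE] := UP k.
  have -> : mu (U k) = (mu (E k) + mu (U k `\` E k))%E.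
    rewrite -measureU//=; last by rewrite setDIK.
    - by rewrite setDUK.
    - exact: mE.
    - by apply: measurableD; [exact: mU|exact: mE].
  rewrite ge0_muleDr//; apply: leeD.
    rewrite -ge0_muleDl//; last 2 first.
    - by rewrite lee_fin mulr_ge0// ltW.
    - by rewrite lee_fin ltW.
    by rewrite -EFinD -natr1 mulrDl mul1r.
  apply: (@le_trans _ _ ((k.+1%:R * e)%:E * (d k)%:E)%E).
    by rewrite lee_pmul2l ?lte_fin ?mulr_gt0 ?ltr0n//; exact: ltW.
  rewrite -EFinM lee_fin /d.
  have k1 : k.+1%:R != 0 :> R by rewrite pnatr_eq0.
  have k2 : (2 ^ k.+1)%:R != 0 :> R by rewrite pnatr_eq0 expn_eq0.
  move: (k.+1%:R : R) ((2 ^ k.+1)%:R : R) k1 k2 => p q p0 q0.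
  by have -> : p * e * (q^-1 / p) = e / q by field; rewrite ?q0 ?p0.
apply: le_trans.
  apply: epsilon_trick; last exact: ltW.
  by move=> n; rewrite adde_ge0// mule_ge0// lee_fin ?mulr_ge0// ltW.
rewrite EFinD addeA; apply: leeD => //.
rewrite nneseriesD; last 2 first.
- by move=> n _ _; rewrite mule_ge0// lee_fin ?mulr_ge0// ltW.
- by move=> n _ _; rewrite mule_ge0// lee_fin ?mulr_ge0// ltW.
apply: leeD.
- rewrite -cE ge0_integral_bigcup//=; last 2 first.
  + by rewrite cE; exact/measurable_EFinP.
  + by move=> x; rewrite cE => xab; rewrite lee_fin h0.
  apply: lee_nneseries => [i _ _|k _].
    by rewrite mule_ge0// lee_fin mulr_ge0// ltW.
  rewrite -integral_cst; last exact: mE.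
  apply: ge0_le_integral => //.
  + exact: mE.
  + by move=> x _; rewrite lee_fin mulr_ge0// ltW.
  + apply/measurable_EFinP; apply: (@measurable_funS _ _ _ _ `]a, b[%classic) mh => //.
    by move=> x [].
  + by move=> x [_ /=]; rewrite in_itv /= lee_fin => /andP[].
- rewrite nneseriesZl//.
  have -> : (\sum_(i <oo) mu (E i) = mu `]a, b[%classic)%E.
    rewrite -cE; apply/esym/measure_semi_bigcup => //.
    by rewrite cE; exact: measurable_itv.
  by rewrite /mu lebesgue_measure_itv /= lte_fin ab.
Qed.

(* Real induction on the set of points where the increment of psi is bounded by
   a weighted measure of the layers, with a slack e absorbing the start at a. *)
Lemma increment_le_integral (R : realType) (a b : R) (psi h : R -> R) :
  a < b -> measurable_fun `]a, b[ h ->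
  (forall x, x \in `]a, b[ -> 0 <= h x) ->
  (forall x, x \in `[a, b] -> forall e : R, 0 < e -> exists2 d : R, 0 < d &
     forall y, y \in `[a, b] -> `|y - x| < d -> `|psi y - psi x| <= e) ->
  (forall x, x \in `]a, b[ -> forall l : R, h x < l -> exists2 d : R, 0 < d &
     forall y, x < y -> y < x + d -> psi y - psi x <= l * (y - x)) ->
  ((psi b - psi a)%:E <= \int[lebesgue_measure]_(x in `]a, b[) (h x)%:E)%E.
Proof.
move=> ab mh h0 cpsi dpsi.
apply/lee_addgt0Pr => e0 e00.
(* The total error will be [e * (b - a) + e] from the cover plus [e] from the start at [a], that is
   [e0]. *)
pose e := e0 / (b - a + 1 + 1).
have ba : 0 < b - a by rewrite subr_gt0.
have e_gt0 : 0 < e by rewrite divr_gt0// addr_gt0// addr_gt0.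
have [U [oU hU sumU]] := layer_cover R a b h e ab e_gt0 mh h0.
pose w k : R := k.+1%:R * e.
have w0 k : 0 <= w k by rewrite mulr_ge0// ltW.
pose mu := @lebesgue_measure R.
have mU k : measurable (U k) by exact: open_measurable.
(* [G] plays the role of an upper primitive of [h]: it is non-decreasing, and over an interval
   inside [U k] it grows with slope at least [w k]. *)
pose G x := (\sum_(k <oo) ((w k)%:E * mu (U k `&` `]a, x]%classic))%E)%E.
have G0 x : (0 <= G x)%E.
  by apply: nneseries_ge0 => k _ _; rewrite mule_ge0// lee_fin.
have Gle x y : x <= y -> (G x <= G y)%E.
  move=> xy; apply: lee_nneseries => [k _ _|k _].
    by rewrite mule_ge0// lee_fin.
  apply: lee_wpmul2l; first by rewrite lee_fin.
  apply: le_measure; rewrite ?inE.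
  - by apply: measurableI; [exact: mU|exact: measurable_itv].
  - by apply: measurableI; [exact: mU|exact: measurable_itv].
  - apply: setIS => z /=; rewrite !in_itv /= => /andP[-> /= zx].
    exact: le_trans zx xy.
have Gjump k x y : a <= x -> x <= y -> `]x, y]%classic `<=` U k ->
    (G x + (w k * (y - x))%:E <= G y)%E.
  move=> ax xy xyU.
  have -> : G y = (\sum_(j <oo) ((w j)%:E * mu (U j `&` `]a, x]%classic)
      + (w j)%:E * mu (U j `&` `]x, y]%classic))%E)%E.
    apply: eq_eseriesr => j _; rewrite -ge0_muleDr//; congr (_ * _)%E.
    rewrite -measureU.
    - rewrite -setIUr; congr (mu (_ `&` _)); apply/seteqP; split => z /=.
        rewrite !in_itv /= => /andP[-> ->]; rewrite andbT /=.
        by case: (leP z x); [left|right].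
      rewrite !in_itv /= => -[/andP[-> /= zx]|/andP[xz -> /=]].
        exact: le_trans zx xy.
      by rewrite andbT (le_lt_trans ax).
    - by apply: measurableI; [exact: mU|exact: measurable_itv].
    - by apply: measurableI; [exact: mU|exact: measurable_itv].
    - apply/seteqP; split => // z [[_ /=] + [_ /=]].
      by rewrite !in_itv /= => /andP[_ zx] /andP[/(le_lt_trans zx)]; rewrite ltxx.
  rewrite nneseriesD; last 2 first.
  - by move=> j _ _; rewrite mule_ge0// lee_fin.
  - by move=> j _ _; rewrite mule_ge0// lee_fin.
  apply: leeD => //.
  (* Of the contributions of []x, y]] only the [k]-th term is kept; it equals [w k * (y - x)]
     because [U k] contains the interval. *)
  rewrite (@nneseriesD1 _ _ k xpredT)//; last first.
    by move=> j _; rewrite mule_ge0// lee_fin.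
  rewrite -[leLHS]adde0; apply: leeD; last first.
    by apply: nneseries_ge0 => j _ _; rewrite mule_ge0// lee_fin.
  rewrite setIidr// EFinM; apply: lee_wpmul2l; first by rewrite lee_fin.
  rewrite /mu lebesgue_measure_itv /= lte_fin; case: ifPn => //.
  by rewrite -leNgt lee_fin subr_le0.
have Gb : (G b <= \int[mu]_(x in `]a, b[) (h x)%:E + (e * (b - a) + e)%:E)%E.
  apply: le_trans sumU; apply: lee_nneseries => [k _ _|k _].
    by rewrite mule_ge0// lee_fin.
  apply: lee_wpmul2l; first by rewrite lee_fin.
  apply: le_measure; rewrite ?inE.
  - by apply: measurableI; [exact: mU|exact: measurable_itv].
  - exact: mU.
  - by move=> x [].
suff main : ((psi b - psi a)%:E <= G b + e%:E)%E.
  apply: (le_trans main); apply: (le_trans (leeD Gb (lexx _))).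
  rewrite -addeA; apply: leeD => //; rewrite -EFinD lee_fin /e.
  suff -> : e0 / (b - a + 1 + 1) * (b - a) + e0 / (b - a + 1 + 1)
            + e0 / (b - a + 1 + 1) = e0 by [].
  by field; apply/eqP; lra.
pose S := [set x | x \in `[a, b] /\ ((psi x - psi a)%:E <= G x + e%:E)%E].
have Sa : S a.
  split; first by rewrite in_itv /= lexx ltW.
  by rewrite subrr adde_ge0// lee_fin ltW.
have Sub : ubound S b by move=> x [] /[!in_itv] /= /andP[].
have hS : has_sup S by split; [exists a|exists b].
pose c := sup S.
have ac : a <= c by apply: ub_le_sup => //; exists b.
have cb : c <= b by apply: ge_sup => //; exists a.
have cab : c \in `[a, b] by rewrite in_itv /= ac cb.
(* [S] contains its supremum, as [psi] is continuous at [c] and [G] is non-decreasing. *)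
have Sc : S c.
  split=> //; apply/lee_addgt0Pr => r r0.
  have [d d0 dP] := cpsi c cab r r0.
  have [x Sx cdx] := sup_adherent d0 hS.
  have [xab psix] := Sx.
  have xc : x <= c by apply: ub_le_sup => //; exists b.
  have /ler_normlP[le1 _] : `|psi x - psi c| <= r.
    by apply: dP => //; rewrite ler0_norm ?subr_le0// opprB ltrBlDr -ltrBlDl.
  apply: (@le_trans _ _ ((psi x - psi a)%:E + r%:E)%E).
    by rewrite -EFinD lee_fin; lra.
  apply: leeD => //; apply: (le_trans psix); apply: leeD => //.
  exact: Gle.
have [<-|cltb] := eqVneq c b; first by case: Sc.
have {cltb}cltb : c < b by rewrite lt_neqAle cltb.
(* When [c < b], a point of [S] beyond [c] contradicts the choice of [c]. *)
suff [y [cy Sy]] : exists y, c < y /\ S y.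
  have : y <= c by apply: ub_le_sup => //; exists b.
  by rewrite leNgt cy.
have [ca|ca] := eqVneq c a.
  (* The slope bound holds only inside the interval; at [a] continuity alone gives a short step
     whose increment fits into the slack [e]. *)
  have [d d0 dP] := cpsi c cab e e_gt0.
  pose m := Num.min (d / 2) (b - c).
  have m0 : 0 < m by rewrite lt_min divr_gt0// subr_gt0.
  have md : m <= d / 2 by rewrite ge_min lexx.
  have mb : m <= b - c by rewrite ge_min lexx orbT.
  exists (c + m); split; first lra.
  have cmab : c + m \in `[a, b] by rewrite in_itv /=; apply/andP; split; lra.
  split => //; rewrite -ca.
  have /ler_normlP[_ le1] : `|psi (c + m) - psi c| <= e.
    apply: dP => //; rewrite (_ : c + m - c = m); last by ring.
    by rewrite gtr0_norm//; lra.
  by rewrite -[leLHS]add0e; apply: leeD.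
have alc : a < c by rewrite lt_neqAle eq_sym ca.
have coab : c \in `]a, b[ by rewrite in_itv /= alc.
(* Since [h c < w k] with [c] in the open set [U k], immediately to the right of [c] the function
   [psi] grows with slope at most [w k] and [G] with slope at least [w k]. *)
have [k Ukc hk] := hU c coab.
have [d d0 dP] := dpsi c coab _ hk.
have [r /= r0 rU] : exists2 r : R, 0 < r & ball c r `<=` U k.
  by have /nbhs_ballP[r r0 rU] := open_nbhs_nbhs (conj (oU k) Ukc); exists r.
pose m := Num.min (Num.min (d / 2) (r / 2)) (b - c).
have m0 : 0 < m by rewrite !lt_min !divr_gt0// subr_gt0.
have md : m <= d / 2 by rewrite !ge_min lexx.
have mr : m <= r / 2 by rewrite !ge_min lexx orbT.
have mb : m <= b - c by rewrite !ge_min lexx !orbT.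
exists (c + m); split; first lra.
split; first by rewrite in_itv /=; apply/andP; split; lra.
have le1 : psi (c + m) - psi c <= w k * (c + m - c) by apply: dP; lra.
apply: (@le_trans _ _ ((psi c - psi a)%:E + (w k * (c + m - c))%:E)%E).
  by rewrite -EFinD lee_fin; lra.
apply: (le_trans (leeD (proj2 Sc) (lexx _))).
rewrite addeAC; apply: leeD => //; apply: Gjump => //; first lra.
move=> z /=; rewrite in_itv /= => /andP[cz zm]; apply: rU.
by rewrite /ball /= ltr_norml; apply/andP; split; lra.
Qed.

Lemma derivable_slope_lt (R : realType) (psi : R -> R) (x l : R) :
  derivable psi x 1 -> derive1 psi x < l ->
  exists2 d : R, 0 < d &
    forall y, x < y -> y < x + d -> psi y - psi x <= l * (y - x).
Proof.
move=> dpsi dl; have l0 : 0 < l - derive1 psi x by rewrite subr_gt0.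
have : (fun h => h^-1 *: (psi (h *: 1 + x) - psi x)) @ 0^' --> derive1 psi x.
  by rewrite derive1E; exact: dpsi.
move=> /cvgrPdist_le/(_ _ l0)[/= d d0 dP]; exists d => // y xy yd.
have yx : 0 < y - x by rewrite subr_gt0.
have := dP (y - x); rewrite /= sub0r normrN gtr0_norm// => /(_ _ (lt0r_neq0 yx)).
rewrite scaler1 subrK => /(_ _)/ler_normlP[]; first lra.
move=> + _; rewrite opprB lerBlDr subrK /GRing.scale /=.
by rewrite mulrC ler_pdivrMr.
Qed.

Lemma within_continuous_dist (R : realType) (a b : R) (psi : R -> R) :
  {within `[a, b], continuous psi} ->
  forall x, x \in `[a, b] -> forall e : R, 0 < e -> exists2 d : R, 0 < d &
     forall y, y \in `[a, b] -> `|y - x| < d -> `|psi y - psi x| <= e.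
Proof.
move=> /subspace_continuousP cpsi x xab e e0.
have /cvgrPdist_le/(_ _ e0)[/= d d0 dP] := cpsi x xab.
exists d => // y yab yx; rewrite distrC; apply: dP => //=.
by rewrite distrC.
Qed.

(** One of [psi] and [- psi] has a non-negative increment, and the one-sided bound applies to it
    because [h] dominates both derivatives. *)
Lemma dist_increment_le_integral (R : realType) (a b : R) (psi h : R -> R) :
  a < b -> measurable_fun `]a, b[ h ->
  {within `[a, b], continuous psi} ->
  (forall x, x \in `]a, b[ -> derivable psi x 1 /\ `|derive1 psi x| <= h x) ->
  ((`|psi b - psi a|)%:E
    <= \int[lebesgue_measure]_(x in `]a, b[) (h x)%:E)%E.
Proof.
move=> ab mh cpsi dpsi.
have h0 x : x \in `]a, b[ -> 0 <= h x.
  by move=> /dpsi[_]; exact: le_trans.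
have cd := within_continuous_dist _ _ _ _ cpsi.
have [_|_] := ger0P (psi b - psi a).
  apply: increment_le_integral => // x xab l hl.
  have [d hd] := dpsi x xab; apply: derivable_slope_lt => //.
  by apply: le_lt_trans hl; exact: le_trans (ler_norm _) hd.
rewrite (_ : - (psi b - psi a) = (- psi b) - (- psi a)); last by ring.
apply: (@increment_le_integral _ _ _ (\- psi)) => //.
  move=> x xab e e0; have [d d0 dP] := cd x xab e e0.
  exists d => // y yab yx /=.
  have -> : - psi y - - psi x = - (psi y - psi x) by ring.
  by rewrite normrN; exact: dP.
move=> x xab l hl.
have [d hd] := dpsi x xab; apply: (@derivable_slope_lt _ (\- psi)) => //.
  exact: derivableN.
rewrite derive1E deriveN// -derive1E.
by apply: le_lt_trans hl; rewrite (le_trans (ler_norm _))// normrN.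
Qed.

(** Induction on the partition with the triangle inequality. Measurability of [h] on the closed
    interval is part of the conclusion because additivity of the integral uses it at each step. *)
Lemma dist_increment_le_integral_partition (R : realType) (a b : R)
    (s : seq R) (psi h : R -> R) :
  itv_partition a b s -> {within `[a, b], continuous psi} ->
  (forall x, 0 <= h x) ->
  (forall i, (i < size s)%N ->
     measurable_fun `](nth b (a :: s) i), (nth b (a :: s) i.+1)[ h /\
     forall x, x \in `](nth b (a :: s) i), (nth b (a :: s) i.+1)[ ->
       derivable psi x 1 /\ `|derive1 psi x| <= h x) ->
  measurable_fun `[a, b] h /\
  ((`|psi b - psi a|)%:E
    <= \int[lebesgue_measure]_(x in `[a, b]) (h x)%:E)%E.
Proof.
move=> + + h0; elim: s a => [|x s IH] a abs cpsi dpsi.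
  rewrite (itv_partition_nil abs) subrr normr0 set_itv1; split.
    exact: measurable_fun_set1.
  by apply: integral_ge0 => z _; rewrite lee_fin.
have xbs := itv_partition_cons abs.
have ax : a < x by case: abs => /= /andP[].
have xb : x <= b := itv_partition_le xbs.
have [mh1 d1] := dpsi 0%N (ltn0Sn _); rewrite /= in mh1 d1.
have [mh2 I2] : measurable_fun `[x, b] h /\ ((`|psi b - psi x|)%:E
    <= \int[lebesgue_measure]_(x in `[x, b]) (h x)%:E)%E.
  apply: IH => //.
  - by apply: continuous_subspaceW cpsi; apply: subset_itvr; rewrite bnd_simp ltW.
  - by move=> i si; exact: (dpsi i.+1).
have mh1' : measurable_fun `[a, x] h.
  by apply/measurable_fun_itv_obnd_cbndP/measurable_fun_itv_bndo_bndcP.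
(* The pieces are made disjoint by opening the second one at [x]; the endpoints are null sets, which
   lets the integrals pass between open and closed intervals. *)
have U : `[a, b]%classic = `[a, x]%classic `|` `]x, b]%classic.
  apply/seteqP; split => z /=; rewrite !in_itv /=.
    by move=> /andP[-> ->]; rewrite andbT; case: (leP z x); [left|right].
  move=> [/andP[-> /= zx]|/andP[xz ->]]; first exact: le_trans zx xb.
  by rewrite andbT (ltW (lt_trans ax xz)).
have mh2' : measurable_fun `]x, b] h by apply/measurable_fun_itv_obnd_cbndP.
have mh : measurable_fun `[a, b] h.
  by rewrite U; apply/measurable_funU => //; split.
split=> //.
have dis : [disjoint `[a, x]%classic & `]x, b]%classic].
  rewrite disj_set2E; apply/eqP/seteqP; split => // z [] /=.
  by rewrite !in_itv /= => /andP[_ zx] /andP[/(le_lt_trans zx)]; rewrite ltxx.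
have mhE : measurable_fun (`[a, x]%classic `|` `]x, b]%classic) (EFin \o h).
  by rewrite -U; exact/measurable_EFinP.
rewrite U ge0_integral_setU; [|exact: measurable_itv|exact: measurable_itv|by []
  |by move=> z _; rewrite lee_fin|by []].
rewrite (@integral_itv_obnd_cbnd _ x (BRight b)); last exact/measurable_EFinP.
rewrite (@integral_itv_bndoo _ a x); last exact/measurable_EFinP.
apply: (@le_trans _ _ (`|psi x - psi a|%:E + `|psi b - psi x|%:E)%E).
  rewrite -EFinD lee_fin (_ : psi b - psi a = (psi x - psi a) + (psi b - psi x)).
    exact: ler_normD.
  by ring.
apply: leeD; last exact: I2.
apply: dist_increment_le_integral => //.
by apply: continuous_subspaceW cpsi; apply: subset_itvl; rewrite bnd_simp.
Qed.

(** The derivative is the pointwise limit of the quotients with step [1 / (n + 1)]. They are formed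
    with the extension [v] of [u] by zero, which is measurable on the whole line and agrees with [u]
    at [t + 1 / (n + 1)] for large [n]. *)
Lemma measurable_derive1 (R : realType) (a b : R) (u : R -> R) :
  (forall x, x \in `]a, b[ -> derivable u x 1) ->
  measurable_fun `]a, b[ (derive1 u).
Proof.
move=> du.
pose v : R -> R := u \_ `]a, b[.
have mu_ : measurable_fun `]a, b[ u.
  apply: open_continuous_measurable_fun; first exact: interval_open.
  move=> x /set_mem xab; apply: differentiable_continuous.
  exact/derivable1_diffP/du.
have mv : measurable_fun setT v.
  by apply/(measurable_restrictT _ _).1 => //; exact: measurable_itv.
apply: (@measurable_fun_cvg _ _ R `]a, b[
  (fun n t => n.+1%:R * (v (t + n.+1%:R^-1) - v t)) (derive1 u)).
  move=> n; apply: measurable_funTS; apply: measurable_funM => //.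
  apply: measurable_funB => //.
  by apply: (measurableT_comp mv); exact: measurable_funD.
move=> x /= xab.
have : (fun h => h^-1 *: (u (h *: 1 + x) - u x)) @ 0^' --> derive1 u x.
  by rewrite derive1E; exact: du.
move=> ucvg.
have hn : (fun n => n.+1%:R^-1 : R) @ \oo --> (0:R)^'.
  move=> A [/= e e0 eA].
  have /cvgrPdist_lt/(_ _ e0) := @cvg_harmonic R.
  apply: filterS => n; rewrite /harmonic /= => nA.
  by apply: eA => //=; rewrite invr_eq0 pnatr_eq0.
have := cvg_comp _ _ hn ucvg; apply: cvg_trans; apply: near_eq_cvg.
have bx : 0 < b - x by move: xab; rewrite in_itv /= subr_gt0 => /andP[].
have /cvgrPdist_lt/(_ _ bx) := @cvg_harmonic R.
apply: filterS => n; rewrite /harmonic /= sub0r normrN gtr0_norm ?invr_gt0// => nb.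
have xnab : x + n.+1%:R^-1 \in `]a, b[.
  move: xab; rewrite /= !in_itv /= => /andP[ax xb]; apply/andP; split; last by rewrite -ltrBrDl.
  by rewrite (lt_trans ax)// ltrDl invr_gt0.
by rewrite invrK scaler1 /v !patchE !mem_set// [_ + x]addrC.
Qed.

(** * Moments of the Laplace distribution *)

Lemma laplace_weight_ge0 (R : realType) (r : R -> R) (s t : R) :
  0 < s -> (forall y : R, 0 <= y -> 0 <= r y) -> 0 <= t ->
  0 <= r (t / s) * (1 / (2 * s) * expR (- (t / s))).
Proof.
move=> s0 r0 t0; apply: mulr_ge0; first by rewrite r0// divr_ge0// ltW.
by apply: mulr_ge0; [rewrite divr_ge0// mulr_ge0// ltW|exact: expR_ge0].
Qed.

(* The antiderivative of r(y) e^(-y) is - q(y) e^(-y); the quadratic bound on q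
   makes it vanish at infinity, as e^y >= y^3 / 6. *)
Lemma integral_laplace_half (R : realType) (q r : R -> R) (m s : R) :
  0 < s -> (forall y : R, is_derive y 1 q (q y - r y)) -> continuous r ->
  (forall y : R, 0 <= y -> 0 <= r y) ->
  (forall y, 1 <= y -> 0 <= q y <= 5 * y ^+ 2) ->
  (\int[lebesgue_measure]_(x in `[m, +oo[)
     (r ((x - m) / s) * (1 / (2 * s) * expR (- ((x - m) / s))))%:E
   = (q 0 / 2)%:E)%E.
Proof.
move=> s0 dq cr r0 qb.
pose Y (x : R) := (x - m) / s.
have dY (x : R) : is_derive x 1 Y s^-1.
  by apply: is_derive_eq; rewrite /GRing.scale /= mulr0 add0r subr0 mulr1.
pose Q (y : R) := - (q y * expR (- y)) / 2.
have dQ (y : R) : is_derive y 1 Q (r y * expR (- y) / 2).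
  have := dq y => dqy.
  apply: is_derive_eq; rewrite /GRing.scale /=; by field.
have dF (x : R) : is_derive x 1 (Q \o Y) (r (Y x) * expR (- Y x) / 2 * s^-1).
  exact: is_derive1_comp.
have cY : continuous Y.
  by move=> x; apply/differentiable_continuous/derivable1_diffP.
have cF (x : R) : {for x, continuous (Q \o Y)}.
  by apply/differentiable_continuous/derivable1_diffP.
rewrite (@ge0_continuous_FTC2y _ _ (Q \o Y) _ 0).
- rewrite /Q /Y /= subrr mul0r oppr0 expR0 mulr1 -EFinB.
  by congr EFin; field.
- by move=> x mx; apply: laplace_weight_ge0; rewrite ?subr_ge0.
- apply: continuous_subspaceT => x; apply: cvgM.
    by apply: continuous_comp; [exact: cY|exact: cr].
  apply: cvgM; first exact: cvg_cst.
  apply: continuous_comp; last exact: continuous_expR.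
  by apply: cvgN; exact: cY.
- apply/cvgrPdist_le => e e0; near=> x.
  have xm : m + s <= x by near: x; apply: nbhs_pinfty_ge; exact: num_real.
  (* With [q y <= 5 y^2] and [e^y >= y^3 / 6], the product [q y * e^(-y)] is at most [30 / y], which
     is at most [e] from [y = 30 / e] on. *)
  have xe : m + s * (30 / e) <= x by near: x; apply: nbhs_pinfty_ge; exact: num_real.
  have y1 : 1 <= Y x by rewrite /Y ler_pdivlMr// mul1r; lra.
  have ye : 30 / e <= Y x by rewrite /Y ler_pdivlMr// mulrC; lra.
  rewrite sub0r normrN /=; move: (Y x) y1 ye => y y1 ye.
  have /andP[q0 q5] := qb y y1.
  rewrite /Q normrM normrN [`|2^-1|]gtr0_norm// ger0_norm; last first.
    by apply: mulr_ge0 => //; exact: expR_ge0.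
  have ey : 30 <= y * e by rewrite -ler_pdivrMr.
  have y3 := expR_ge1Dxn 2 (le_trans ler01 y1).
  have qe : q y * expR (- y) <= e.
    rewrite expRN ler_pdivrMr ?expR_gt0//.
    apply: (le_trans q5); apply: (@le_trans _ _ (e * (y ^+ 3 / 6))).
      have : 0 <= y ^+ 2 * (y * e - 30) by rewrite mulr_ge0 ?sqr_ge0 ?subr_ge0.
      by rewrite exprS; lra.
    apply: ler_wpM2l; first exact: ltW.
    by apply: le_trans y3; rewrite (_ : 3`! = 6)%N// lerDr.
  have := mulr_ge0 q0 (expR_ge0 (- y)); lra.
- by move=> x _; have [] := dF x.
- by apply/cvg_at_right_filter; exact: cF.
- move=> x _; rewrite derive1E; have [_ ->] := dF x.
  by rewrite /Y; field; rewrite gt_eqF.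
Unshelve. all: end_near.
Qed.

(** The substitution [x -> - x] carries this half-line to the one starting at [- m]. *)
Lemma integral_laplace_half_left (R : realType) (q r : R -> R) (m s : R) :
  0 < s -> (forall y : R, is_derive y 1 q (q y - r y)) -> continuous r ->
  (forall y : R, 0 <= y -> 0 <= r y) ->
  (forall y, 1 <= y -> 0 <= q y <= 5 * y ^+ 2) ->
  (\int[lebesgue_measure]_(x in `]-oo, m])
     (r ((m - x) / s) * (1 / (2 * s) * expR (- ((m - x) / s))))%:E
   = (q 0 / 2)%:E)%E.
Proof.
move=> s0 dq cr r0 qb.
rewrite -(integral_laplace_half _ _ _ (- m) _ s0 dq cr r0 qb).
pose G x := r ((m - x) / s) * (1 / (2 * s) * expR (- ((m - x) / s))).
have cG : continuous G.
  have cY : continuous (fun x : R => (m - x) / s).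
    move=> x; apply: cvgM; last exact: cvg_cst.
    by apply: cvgB; [exact: cvg_cst|exact: cvg_id].
  move=> x; apply: cvgM.
    by apply: continuous_comp; [exact: cY|exact: cr].
  apply: cvgM; first exact: cvg_cst.
  apply: continuous_comp; last exact: continuous_expR.
  by apply: cvgN; exact: cY.
have := @ge0_integration_by_substitutionNy _ G (- m).
rewrite opprK => ->.
- by apply: eq_integral => x _; rewrite /G /= !opprK [m + _]addrC.
- exact: continuous_subspaceT.
- move=> x; rewrite in_itv /= => xm; apply: laplace_weight_ge0 => //.
  by rewrite subr_ge0 ltW.
Qed.

Lemma continuous_laplace_weight (R : realType) (r : R -> R) (m s : R) :
  continuous r -> continuous (fun x : R =>
    r (`|x - m| / s) * (1 / (2 * s) * expR (- (`|x - m| / s)))).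
Proof.
move=> cr.
have cY : continuous (fun x : R => `|x - m| / s).
  move=> x; apply: cvgM; last exact: cvg_cst.
  apply: cvg_norm.
  by apply: cvgB; [exact: cvg_id|exact: cvg_cst].
move=> x; apply: cvgM.
  by apply: continuous_comp; [exact: cY|exact: cr].
apply: cvgM; first exact: cvg_cst.
apply: continuous_comp; last exact: continuous_expR.
by apply: cvgN; exact: cY.
Qed.

Section LaplaceMoments.
Context (R : realType) (q r : R -> R) (m s : R).
Hypotheses (s0 : 0 < s) (dq : forall y : R, is_derive y 1 q (q y - r y))
  (cr : continuous r) (r0 : forall y : R, 0 <= y -> 0 <= r y)
  (qb : forall y, 1 <= y -> 0 <= q y <= 5 * y ^+ 2).

Let f (x : R) := r (`|x - m| / s) * (1 / (2 * s) * expR (- (`|x - m| / s))).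

Let mf : measurable_fun setT f.
Proof. by apply: continuous_measurable_fun; exact: continuous_laplace_weight. Qed.

Let f0 x : 0 <= f x.
Proof. exact: laplace_weight_ge0. Qed.

Let itvT : [set: R] = `]-oo, m[%classic `|` `[m, +oo[%classic.
Proof.
apply/seteqP; split => // x _ /=; rewrite !in_itv /= andbT.
by case: (ltP x m); [left|right].
Qed.

Let disjT : [disjoint `]-oo, m[%classic & `[m, +oo[%classic].
Proof.
rewrite disj_set2E; apply/eqP/seteqP; split => // x [] /=.
by rewrite !in_itv /= andbT => /lt_le_trans xm /xm; rewrite ltxx.
Qed.

Let fR : (\int[lebesgue_measure]_(x in `[m, +oo[) (f x)%:E = (q 0 / 2)%:E)%E.
Proof.
rewrite -(integral_laplace_half _ _ _ m _ s0 dq cr r0 qb).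
apply: eq_integral => x /set_mem /=; rewrite in_itv /= andbT => mx.
by rewrite /f ger0_norm// subr_ge0.
Qed.

Let fL : (\int[lebesgue_measure]_(x in `]-oo, m[) (f x)%:E = (q 0 / 2)%:E)%E.
Proof.
rewrite integral_itv_bndo_bndc; last first.
  by apply/measurable_EFinP; exact: measurable_funTS.
rewrite -(integral_laplace_half_left _ _ _ m _ s0 dq cr r0 qb).
apply: eq_integral => x /set_mem /=; rewrite in_itv /= => mx.
by rewrite /f distrC ger0_norm// subr_ge0.
Qed.

(** Each side of [m] contributes [q 0 / 2]; a non-negative function with finite integral is
    integrable. *)
Lemma laplace_even_moment :
  lebesgue_measure.-integrable [set: R] (EFin \o f) /\
  (\int[lebesgue_measure]_x (f x)%:E = (q 0)%:E)%E.
Proof.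
have fT : (\int[lebesgue_measure]_x (f x)%:E = (q 0)%:E)%E.
  rewrite itvT integral_setU; [|exact: measurable_itv|exact: measurable_itv
    |by apply/measurable_EFinP; exact: measurable_funTS|exact: disjT].
  by rewrite fL fR -EFinD -splitr.
split=> //; apply/integrableP; split; first exact/measurable_EFinP.
under eq_integral do rewrite /= ger0_norm//.
by rewrite fT ltry.
Qed.

(** The two sides of [m] contribute [q 0 / 2] with opposite signs. Integrability follows by
    domination by [f]. *)
Lemma laplace_odd_moment :
  lebesgue_measure.-integrable [set: R] (EFin \o (fun x => Num.sg (x - m) * f x)) /\
  (\int[lebesgue_measure]_x (Num.sg (x - m) * f x)%:E = 0)%E.
Proof.
have [intf _] := laplace_even_moment.
have ms : measurable_fun setT (fun x : R => Num.sg (x - m)).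
  apply: nondecreasing_measurable => // x y xy.
  by case: (sgrP (x - m)); case: (sgrP (y - m)) => * //; lra.
have msf : measurable_fun setT (fun x : R => Num.sg (x - m) * f x).
  exact: measurable_funM.
split.
  apply: (le_integrable _ _ _ intf) => //; first exact/measurable_EFinP.
  move=> x _ /=; rewrite lee_fin normrM ler_piMl//.
  by rewrite normr_sg lern1 leq_b1.
rewrite itvT integral_setU; [|exact: measurable_itv|exact: measurable_itv
    |by apply/measurable_EFinP; exact: measurable_funTS|exact: disjT].
(* The null point [m], where the sign is 0, is removed so that the sign is 1 on the whole right
   half-line. *)
rewrite -integral_itv_obnd_cbnd; last first.
  by apply/measurable_EFinP; exact: measurable_funTS.
have -> : (\int[lebesgue_measure]_(x in `]-oo, m[) (Num.sg (x - m) * f x)%:E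
    = - (q 0 / 2)%:E)%E.
  rewrite -fL -integral_ge0N; last by move=> x _; rewrite lee_fin.
  apply: eq_integral => x /set_mem /=; rewrite in_itv /= => xm.
  by rewrite ltr0_sg ?subr_lt0// mulN1r.
have -> : (\int[lebesgue_measure]_(x in `]m, +oo[) (Num.sg (x - m) * f x)%:E
    = (q 0 / 2)%:E)%E.
  rewrite -fR -integral_itv_obnd_cbnd; last first.
    by apply/measurable_EFinP; exact: measurable_funTS.
  apply: eq_integral => x /set_mem /=; rewrite in_itv /= andbT => xm.
  by rewrite gtr0_sg ?subr_gt0// mul1r.
by rewrite -EFinN -EFinD addNr.
Qed.

End LaplaceMoments.

(** * The Fisher matrix *)

(** A directional derivative and the derivative at 0 of the restriction to the line have the same
    difference quotients. This turns the scores into one-variable derivatives. *)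
Lemma is_derive_along (R : realType) (V : normedModType R) (f : V -> R)
    (a v : V) (d : R) :
  is_derive (0 : R) 1 (fun h : R => f (h *: v + a)) d -> is_derive a v f d.
Proof.
set phi := fun h : R => f (h *: v + a).
have E : (fun h : R => h^-1 *: ((f \o shift a) (h *: v) - f a)) =
         (fun h : R => h^-1 *: ((phi \o shift 0) (h *: 1) - phi 0)).
  by apply/funext => h; rewrite /phi /= scale0r add0r addr0 scaler1.
move=> [dphi dE]; constructor; first by rewrite /derivable E.
by rewrite -dE /derive E.
Qed.

Lemma ln_laplace (R : realType) (t w : R) : 0 < t ->
  ln (1 / (2 * t) * expR (- (w / t))) = - ln (2 * t) - w / t.
Proof.
move=> t0; have t2 : 0 < 2 * t by rewrite mulr_gt0.
rewrite div1r [LHS]lnM ?posrE ?invr_gt0 ?expR_gt0//.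
by rewrite [X in _ + X]expRK [X in X + _]lnV ?posrE.
Qed.

Section LaplaceFisher.
Context (R : realType) (xi : 'rV[R]_2).
Hypothesis s_gt0 : 0 < xi 0 1.
Notation m := (xi 0 0).
Notation s := (xi 0 1).

Lemma is_derive_ln_laplace_mu (x : R) : x != m ->
  is_derive xi (delta_mx 0 0 : 'rV[R]_2) (fun eta => ln (laplace_pdf eta x))
    (Num.sg (x - m) / s).
Proof.
move=> xm; apply: is_derive_along.
(* For [|h| < |x - m|] the sign of [x - (h + m)] is that of [x - m], so the absolute value can be
   replaced by an affine function of [h]. *)
apply: (@near_eq_is_derive _ _ _
  (fun h : R => - ln (2 * s) - (Num.sg (x - m) * (x - (h + m))) / s)).
  have d0 : 0 < `|x - m| by rewrite normr_gt0 subr_eq0.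
  exists `|x - m| => //= h /=; rewrite sub0r normrN => hx.
  rewrite /laplace_pdf !mxE /= mulr0 add0r mulr1 ln_laplace//.
  congr (_ - _ / _); move: hx.
  case: (sgrP (x - m)) d0 => xm0 d0 /ltr_normlP[h1 h2].
  - by rewrite ltxx in d0.
  - by rewrite mul1r ger0_norm//; lra.
  - by rewrite mulN1r ler0_norm; lra.
apply: is_derive_eq; rewrite /GRing.scale /=; field.
by rewrite gt_eqF.
Qed.

Lemma is_derive_ln_laplace_sigma (x : R) :
  is_derive xi (delta_mx 0 1 : 'rV[R]_2) (fun eta => ln (laplace_pdf eta x))
    ((`|x - m| / s - 1) / s).
Proof.
apply: is_derive_along.
apply: (@near_eq_is_derive _ _ _
  (fun h : R => - ln (2 * (h + s)) - `|x - m| * (h + s)^-1)).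
  (* Radius [s] keeps the scale [h + s] positive, as the formula for the logarithm of the density
     requires. *)
  exists s => //= h /=; rewrite sub0r normrN => /ltr_normlP[h1 h2].
  rewrite /laplace_pdf !mxE /= mulr0 add0r mulr1 ln_laplace//; lra.
have l2s : 0 < 2 * (0 + s) by rewrite add0r mulr_gt0.
have hs : (0 + s) != 0 by rewrite add0r gt_eqF.
have := is_derive1_ln l2s => hl.
have hw : is_derive (0 : R) 1 (fun h : R => 2 * (h + s)) 2.
  by apply: is_derive_eq; rewrite /GRing.scale /=; ring.
have hi : is_derive (0 : R) 1 (fun h : R => (h + s)^-1) (- (0 + s) ^- 2 *: (1 + 0)).
  exact: is_deriveV.
have hc' : is_derive (0 : R) 1 (fun h : R => ln (2 * (h + s))) ((2 * (0 + s))^-1 * 2) :=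
  @is_derive1_comp _ _ (fun h : R => 2 * (h + s)) _ _ _ hl hw.
apply: is_derive_eq; rewrite /GRing.scale /=; field.
by rewrite gt_eqF.
Qed.

End LaplaceFisher.

(** A singleton is measurable and null. This serves for products containing the score in [mu], whose
    formula is established only away from [x = mu]. *)
Lemma integrable_eq_off_point (R : realType) (f g : R -> R) (m : R) :
  lebesgue_measure.-integrable [set: R] (EFin \o g) ->
  (forall x, x != m -> f x = g x) ->
  lebesgue_measure.-integrable [set: R] (EFin \o f) /\
  (\int[lebesgue_measure]_x (f x)%:E = \int[lebesgue_measure]_x (g x)%:E)%E.
Proof.
move=> /[dup] intg /integrableP[/measurable_EFinP mg gy] fg.
have mf' : measurable_fun (~` [set m]) f.
  apply: (@eq_measurable_fun _ _ _ _ _ g); last exact: measurable_funTS.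
  by move=> x /set_mem /= /eqP xm; rewrite fg.
have mf : measurable_fun setT f.
  rewrite -(setUv [set m]); apply/measurable_funU => //; first exact: measurableC.
  by split => //; exact: measurable_fun_set1.
have off (u v : R -> \bar R) : measurable_fun setT u -> measurable_fun setT v ->
    (forall x, x != m -> u x = v x) ->
    (\int[lebesgue_measure]_x u x = \int[lebesgue_measure]_x v x)%E.
  move=> mu mv uv; have mD : measurable ([set: R] `\ m) by exact: measurableD.
  rewrite -(@integral_setD1 R u m setT mD); last exact: measurable_funS mu.
  rewrite -(@integral_setD1 R v m setT mD); last exact: measurable_funS mv.
  by apply: eq_integral => x /set_mem [_ /= /eqP]; exact: uv.
split; last by apply: off => [||x /fg ->//]; exact/measurable_EFinP.
apply/integrableP; split; first exact/measurable_EFinP.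
rewrite (off _ (fun x => `|(g x)%:E|%E))//.
- by apply: measurableT_comp => //; exact/measurable_EFinP.
- by apply: measurableT_comp => //; exact/measurable_EFinP.
- by move=> x /fg /= ->.
Qed.

Section LaplaceFisherMatrix.
Context (R : realType) (xi : 'rV[R]_2).
Hypothesis s_gt0 : 0 < xi 0 1.
Notation m := (xi 0 0).
Notation s := (xi 0 1).
Notation mu := (@lebesgue_measure R).

Let p := laplace_pdf xi.

Let s_neq0 : s != 0. Proof. by rewrite gt_eqF. Qed.

Let one_even : mu.-integrable [set: R] (EFin \o p) /\
  (\int[mu]_x (p x)%:E = 1)%E.
Proof.
have [||||h1 h2] := @laplace_even_moment R (cst 1) (cst 1) m s s_gt0.
- by move=> y; rewrite subrr; exact: is_derive_cst.
- exact: cst_continuous.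
- by [].
- by move=> y y1 /=; nra.
have E : p = fun x => cst 1 (`|x - m| / s) * (1 / (2 * s) * expR (- (`|x - m| / s))).
  by apply/funext => x; rewrite /= mul1r.
by rewrite E.
Qed.

Let one_odd : mu.-integrable [set: R] (EFin \o (fun x => Num.sg (x - m) * p x)) /\
  (\int[mu]_x (Num.sg (x - m) * p x)%:E = 0)%E.
Proof.
have [||||h1 h2] := @laplace_odd_moment R (cst 1) (cst 1) m s s_gt0.
- by move=> y; rewrite subrr; exact: is_derive_cst.
- exact: cst_continuous.
- by [].
- by move=> y y1 /=; nra.
have E : p = fun x => cst 1 (`|x - m| / s) * (1 / (2 * s) * expR (- (`|x - m| / s))).
  by apply/funext => x; rewrite /= mul1r.
by rewrite E.
Qed.

Let id_odd : mu.-integrable [set: R]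
    (EFin \o (fun x => Num.sg (x - m) * (`|x - m| / s * p x))) /\
  (\int[mu]_x (Num.sg (x - m) * (`|x - m| / s * p x))%:E = 0)%E.
Proof.
(* For [r = y] the equation [q' = q - r] is solved by [q = y + 1]. *)
apply: (@laplace_odd_moment R (fun y => y + 1) id m s s_gt0).
- move=> y; apply: is_derive_eq; ring.
- by move=> y; exact: cvg_id.
- by [].
- by move=> y y1; nra.
Qed.

Let sqr_even : mu.-integrable [set: R]
    (EFin \o (fun x => (`|x - m| / s - 1) ^+ 2 * p x)) /\
  (\int[mu]_x ((`|x - m| / s - 1) ^+ 2 * p x)%:E = 1)%E.
Proof.
(* For [r = (y - 1)^2] the solution is [q = y^2 + 1], so the moment is [q 0 = 1]. *)
have [||||h1 h2] := @laplace_even_moment R (fun y => y ^+ 2 + 1)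
  (fun y => (y - 1) ^+ 2) m s s_gt0.
- by move=> y; apply: is_derive_eq; rewrite /GRing.scale /=; ring.
- by move=> y; exact/differentiable_continuous/derivable1_diffP.
- by move=> y _; exact: sqr_ge0.
- by move=> y y1; nra.
by split => //; rewrite h2 expr0n /= add0r.
Qed.

Lemma laplace_is_density : is_density p.
Proof.
have [intp intp1] := one_even; split => //.
- by apply/measurable_EFinP; case/integrableP: intp.
- move=> x; rewrite /p /laplace_pdf mulr_ge0 ?expR_ge0//.
  by rewrite divr_ge0// mulr_ge0// ltW.
Qed.

Lemma score_laplace_mu (x : R) : x != m ->
  score laplace_pdf xi 0 x = Num.sg (x - m) / s.
Proof. by move=> xm; have [] := is_derive_ln_laplace_mu R xi s_gt0 x xm. Qed.

Lemma score_laplace_sigma (x : R) :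
  score laplace_pdf xi 1 x = (`|x - m| / s - 1) / s.
Proof. by have [] := is_derive_ln_laplace_sigma R xi s_gt0 x. Qed.

Let ord2 (i : 'I_2) : i = 0 \/ i = 1.
Proof. by case: i => [[|[|//]] ?]; [left|right]; exact/val_inj. Qed.

(** With [y = |x - m| / s] and [x] different from [m], the products of scores are [1 / s^2] times
    [1], [sg (x - m) * (y - 1)] or [(y - 1)^2], whose means are 1, 0 and 1. *)
Lemma laplace_fisher_entry (i j : 'I_2) :
  mu.-integrable [set: R] (EFin \o
    (fun x => score laplace_pdf xi i x * score laplace_pdf xi j x * p x)) /\
  (\int[mu]_x (score laplace_pdf xi i x * score laplace_pdf xi j x * p x)%:E
   = ((1 / s ^+ 2) *+ (i == j))%:E)%E.
Proof.
pose w : R := 1 / s ^+ 2.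
have scaled (g : R -> R) (l : R) : mu.-integrable [set: R] (EFin \o g) ->
    (\int[mu]_x (g x)%:E = l%:E)%E ->
    (forall x, x != m ->
      score laplace_pdf xi i x * score laplace_pdf xi j x * p x = w * g x) ->
    mu.-integrable [set: R] (EFin \o
      (fun x => score laplace_pdf xi i x * score laplace_pdf xi j x * p x)) /\
    (\int[mu]_x (score laplace_pdf xi i x * score laplace_pdf xi j x * p x)%:E
     = (w * l)%:E)%E.
  move=> ig gl eg.
  have iwg : mu.-integrable [set: R] (EFin \o (fun x => w * g x)).
    by have := @integrableZl _ _ _ mu setT measurableT w _ ig.
  have [h1 h2] := integrable_eq_off_point _ _ _ _ iwg eg.
  split=> //; rewrite h2.
  under eq_integral do rewrite EFinM.
  by rewrite (integralZl measurableT ig) gl EFinM.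
(* The mixed product is the difference of the odd moments for [r = y] and [r = 1], both zero. *)
have cross : mu.-integrable [set: R] (EFin \o (fun x =>
      Num.sg (x - m) * (`|x - m| / s * p x) - Num.sg (x - m) * p x)) /\
    (\int[mu]_x (Num.sg (x - m) * (`|x - m| / s * p x) - Num.sg (x - m) * p x)%:E
     = 0)%E.
  have [ia a0] := id_odd; have [ib b0] := one_odd; split.
    by have := integrableB measurableT ia ib.
  under eq_integral do rewrite EFinB.
  by rewrite (integralB measurableT ia ib) a0 b0 sube0.
have [i0|i1] := ord2 i; have [j0|j1] := ord2 j; subst i j; rewrite -/w.
- have [i1 l1] := one_even.
  have := scaled _ _ i1 l1; rewrite mulr1 => H; apply: H => x xm.
  rewrite score_laplace_mu// /w.
  have : Num.sg (x - m) * Num.sg (x - m) = 1 by rewrite -expr2 sqr_sg subr_eq0 xm.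
  move: (Num.sg _) => g gg.
  have -> : g / s * (g / s) * p x = (g * g) * (1 / s ^+ 2 * p x) by field.
  by rewrite gg mul1r.
- have [i1 l1] := cross.
  have := scaled _ _ i1 l1; rewrite mulr0 => H; apply: H => x xm.
  by rewrite score_laplace_mu// score_laplace_sigma /w; field.
- have [i1 l1] := cross.
  have := scaled _ _ i1 l1; rewrite mulr0 => H; apply: H => x xm.
  by rewrite score_laplace_mu// score_laplace_sigma /w; field.
- have [i1 l1] := sqr_even.
  have := scaled _ _ i1 l1; rewrite mulr1 => H; apply: H => x xm.
  by rewrite score_laplace_sigma /w; field.
Qed.

Lemma laplace_fisher_matrix_exists : fisher_matrix_exists laplace_pdf xi.
Proof.
split; last by move=> i j; have [] := laplace_fisher_entry i j.
(* The exceptional null set is the kink of the density at [x = m]. *)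
exists [set m]; split; [exact: measurable_set1|exact: lebesgue_measure_set1|].
move=> x /= nx; apply: contrapT => xm; apply: nx => i.
have [->|->] := ord2 i.
  by have [] := is_derive_ln_laplace_mu R xi s_gt0 x (introN eqP xm).
by have [] := is_derive_ln_laplace_sigma R xi s_gt0 x.
Qed.

Lemma laplace_fisher_matrixE :
  fisher_matrix laplace_pdf xi = (1 / s ^+ 2)%:M.
Proof.
apply/matrixP => i j; rewrite !mxE /expectation_under /Rintegral.
by have [_ ->] := laplace_fisher_entry i j.
Qed.

End LaplaceFisherMatrix.

(** * Potentials and the lower bound *)

Lemma laplace_speed (R : realType) (xi d : 'rV[R]_2) : 0 < xi 0 1 ->
  Num.sqrt ((d *m fisher_matrix laplace_pdf xi *m d^T) 0 0)
  = Num.sqrt (d 0 0 ^+ 2 + d 0 1 ^+ 2) / xi 0 1.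
Proof.
move=> s0; rewrite (laplace_fisher_matrixE _ _ s0) mul_mx_scalar -scalemxAl mxE.
rewrite sqrtrM; last by rewrite divr_ge0// sqr_ge0.
rewrite div1r sqrtrV ?sqr_ge0// sqrtr_sqr gtr0_norm// mulrC; congr (Num.sqrt _ / _).
by rewrite mxE big_ord_recl big_ord1 !mxE -!expr2; congr (_ ^+ 2 + d _ _ ^+ 2); exact/val_inj.
Qed.

(** At an interior point, [t + h] stays in the interval for small [h], so the limit relative to the
    interval is the two-sided one. *)
Lemma differentiable_on_itv_interior (R : realType) (d : nat) (a b : R)
    (c : R -> 'rV[R]_d) (t : R) :
  differentiable_on_itv a b c -> t \in `]a, b[ -> derivable c t 1.
Proof.
move=> dc tab; have tab' : t \in `[a, b] by exact: subset_itv_oo_cc tab.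
have /cvg_ex[l cl] := dc t tab'.
apply/cvg_ex; exists l.
have hs : (fun h : R => h *: 1 + t) @ 0^' -->
    within (`[a, b]%classic `\ t) (nbhs t).
  move=> A /= [e e0 eA].
  move: tab; rewrite in_itv /= => /andP[ta tb].
  exists (Num.min e (Num.min (t - a) (b - t))) => /=.
    by rewrite !lt_min e0 !subr_gt0 ta.
  move=> h /=; rewrite sub0r normrN !lt_min => /and3P[he ha hb] h0.
  rewrite scaler1; apply: eA => /=.
    by rewrite opprD addrCA subrr addr0 normrN.
  move: ha hb => /ltr_normlP[h1 h2] /ltr_normlP[h3 h4].
  split; first by rewrite in_itv /=; apply/andP; split; lra.
  by move=> /eqP; rewrite -subr_eq0 addrK; exact/negP.
have := cvg_comp _ _ hs cl; apply: cvg_trans; apply: near_eq_cvg.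
by near=> h; rewrite /= addrK scaler1.
Unshelve. all: end_near.
Qed.

Lemma derivable_differentiable_on_itv (R : realType) (d : nat) (a b : R)
    (c : R -> 'rV[R]_d) :
  (forall t, derivable c t 1) -> differentiable_on_itv a b c.
Proof.
move=> dc t tab; have /cvg_ex[l cl] := dc t.
apply/cvg_ex; exists l.
have hs : (fun s : R => s - t) @ within (`[a, b]%classic `\ t) (nbhs t) --> (0 : R)^'.
  move=> A /= [e e0 eA]; exists e => //= s ts [_ st].
  by apply: eA => /=; rewrite ?sub0r ?opprB// subr_eq0; apply/eqP.
have := cvg_comp _ _ hs cl; apply: cvg_trans; apply: near_eq_cvg.
by near=> s; rewrite /= scaler1 subrK.
Unshelve. all: end_near.
Qed.

Lemma derive1_coord (R : realType) (d : nat) (c : R -> 'rV[R]_d) (t : R) (i : 'I_d) :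
  derivable c t 1 ->
  derivable (fun t => c t 0 i) t 1 /\ derive1 c t 0 i = derive1 (fun t => c t 0 i) t.
Proof.
move=> dc; split; first exact: (derivable_mxP _ _ _).1 dc 0 i.
by rewrite !derive1E (derive_mx dc) mxE.
Qed.

(** Continuity of [Phi] on the upper half-plane, stated along an arbitrary filter so that it
    composes with a curve restricted to [[0, 1]], endpoints included. *)
Definition laplace_potential_cvg (R : realType) (Phi : R -> R -> R) : Prop :=
  forall (F : set_system R) (u v : R -> R) (a b : R), Filter F -> 0 < b ->
     u @ F --> a -> v @ F --> b -> (fun t => Phi (u t) (v t)) @ F --> Phi a b.

(* The gradient of Phi for the Fisher metric has norm at most 1, tested along
   curves (u, v) in order to avoid total derivatives in the plane. *)
Definition laplace_potential_lip (R : realType) (Phi : R -> R -> R) : Prop :=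
  forall (u v : R -> R) (t du dv : R), 0 < v t ->
     is_derive t 1 u du -> is_derive t 1 v dv ->
     exists2 D : R, is_derive t 1 (fun t => Phi (u t) (v t)) D &
       `|D| <= Num.sqrt (du ^+ 2 + dv ^+ 2) / v t.

(** Along the curve, [psi = Phi (c t)] is continuous, and inside each piece its derivative is
    bounded by the Fisher speed [h]; the increment inequality over the partition then applies. *)
Lemma fisher_length_ge_potential (R : realType) (Phi : R -> R -> R)
    (xi1 xi2 : 'rV[R]_2) (c : R -> 'rV[R]_2) :
  laplace_potential_cvg _ Phi -> laplace_potential_lip _ Phi ->
  admissible_curve laplace_domain xi1 xi2 c ->
  ((`|Phi (xi2 0 0) (xi2 0 1) - Phi (xi1 0 0) (xi1 0 1)|)%:E
    <= fisher_length laplace_pdf c)%E.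
Proof.
move=> cPhi dPhi [[cc [s [s01 ds]]] cdom <- <-].
pose h t := Num.sqrt
  ((derive1 c t *m fisher_matrix laplace_pdf (c t) *m (derive1 c t)^T) 0 0).
pose psi t := Phi (c t 0 0) (c t 0 1).
suff [] : measurable_fun `[0 : R, 1] h /\
    ((`|psi 1 - psi 0|)%:E <= \int[lebesgue_measure]_(x in `[0%R : R, 1%R]) (h x)%:E)%E.
  by [].
apply: (dist_increment_le_integral_partition _ _ _ _ _ _ s01).
- apply/subspace_continuousP => t t01.
  have /subspace_continuousP/(_ t t01) ct0 := cc.
  have ct : c @ within `[0 : R, 1]%classic (nbhs t) --> c t by exact: ct0.
  apply: cPhi; first by exact: cdom.
    exact: (cvg_comp _ _ ct (@coord_continuous R _ _ 0 0 (c t))).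
  exact: (cvg_comp _ _ ct (@coord_continuous R _ _ 0 1 (c t))).
- by move=> x; exact: sqrtr_ge0.
move=> i si; set a := nth _ _ i; set b := nth _ _ i.+1.
have a0 : 0 <= a by apply: itv_partition_nth_ge s01; rewrite ltnS ltnW.
have b1 : b <= 1 by apply: itv_partition_nth_le s01.
have sub x : x \in `]a, b[ -> x \in `[0 : R, 1].
  by rewrite !in_itv /= => /andP[ax xb]; apply/andP; split; lra.
have dc x : x \in `]a, b[ -> derivable c x 1.
  exact: differentiable_on_itv_interior (ds i si).
have pos x : x \in `]a, b[ -> 0 < c x 0 1 by move=> /sub /cdom.
pose u t := c t 0 0; pose v t := c t 0 1.
have hE x : x \in `]a, b[ -> h x = Num.sqrt (derive1 u x ^+ 2 + derive1 v x ^+ 2) / v x.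
  move=> xab; rewrite /h laplace_speed; last exact: pos.
  have [_ ->] := derive1_coord _ _ _ _ 0 (dc x xab).
  by have [_ ->] := derive1_coord _ _ _ _ 1 (dc x xab).
have du x : x \in `]a, b[ -> derivable u x 1.
  by move=> xab; have [] := derive1_coord _ _ _ _ 0 (dc x xab).
have dv x : x \in `]a, b[ -> derivable v x 1.
  by move=> xab; have [] := derive1_coord _ _ _ _ 1 (dc x xab).
have mdu := measurable_derive1 _ _ _ _ du.
have mdv := measurable_derive1 _ _ _ _ dv.
split.
  (* The speed is measurable on the piece, being built from derivatives of the coordinates and the
     continuous function [1 / v]. *)
  apply: (@eq_measurable_fun _ _ _ _ _
    (fun x => Num.sqrt (derive1 u x ^+ 2 + derive1 v x ^+ 2) * (v x)^-1)).
    by move=> x /set_mem xab; rewrite hE.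
  apply: measurable_funM.
    have msqrt : measurable_fun setT (@Num.sqrt R).
      by apply: continuous_measurable_fun; exact: sqrt_continuous.
    apply: (measurableT_comp msqrt).
    by apply: measurable_funD; exact: measurable_funX.
  apply: open_continuous_measurable_fun; first exact: interval_open.
  move=> x /set_mem xab; apply: cvgV; first by rewrite gt_eqF// pos.
  exact/differentiable_continuous/derivable1_diffP/dv.
move=> x xab.
have ux : is_derive x 1 u (derive1 u x) by rewrite derive1E; exact/derivableP/du.
have vx : is_derive x 1 v (derive1 v x) by rewrite derive1E; exact/derivableP/dv.
have [D [dD DE] Dle] := dPhi u v x _ _ (pos x xab) ux vx.
by split=> //; rewrite hE// derive1E DE.
Qed.

(** * Geodesics *)

Lemma laplace_param0 (R : realType) (mu sigma : R) :
  laplace_param mu sigma 0 0 = mu.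
Proof. by rewrite mxE. Qed.

Lemma laplace_param1 (R : realType) (mu sigma : R) :
  laplace_param mu sigma 0 1 = sigma.
Proof. by rewrite mxE. Qed.

(** A calibration argument: the unit-speed curve [(M, S)] realises the length [|s2 - s1|], and since
    [Phi] equals the parameter along it, the potential bound gives the same value from below. *)
Lemma fisher_rao_distance_geodesic (R : realType) (Phi : R -> R -> R)
    (M S dM dS : R -> R) (s1 s2 : R) :
  laplace_potential_cvg _ Phi -> laplace_potential_lip _ Phi ->
  (forall s : R, is_derive s 1 M (dM s)) -> (forall s : R, is_derive s 1 S (dS s)) ->
  (forall s, 0 < S s) -> (forall s, dM s ^+ 2 + dS s ^+ 2 = S s ^+ 2) ->
  (forall s, Phi (M s) (S s) = s) ->
  fisher_rao_distance laplace_pdf laplace_domain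
    (laplace_param (M s1) (S s1)) (laplace_param (M s2) (S s2))
  = (`|s2 - s1|)%:E.
Proof.
move=> cPhi lPhi hM hS S0 speed PhiK.
(* Affine reparametrisation over [[0, 1]], with constant Fisher speed [|s2 - s1|], in either order
   of [s1] and [s2]. *)
pose L (t : R) := s1 + t * (s2 - s1).
pose c (t : R) := laplace_param (M (L t)) (S (L t)).
have dL (t : R) : is_derive t 1 L (s2 - s1).
  by apply: is_derive_eq; rewrite /GRing.scale /=; ring.
have dML (t : R) : is_derive t 1 (fun t => M (L t)) (dM (L t) * (s2 - s1)).
  exact: is_derive1_comp.
have dSL (t : R) : is_derive t 1 (fun t => S (L t)) (dS (L t) * (s2 - s1)).
  exact: is_derive1_comp.
have c0E : (fun t => c t 0 0) = (fun t => M (L t)).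
  by apply/funext => t; rewrite /c laplace_param0.
have c1E : (fun t => c t 0 1) = (fun t => S (L t)).
  by apply/funext => t; rewrite /c laplace_param1.
have dc (t : R) : derivable c t 1.
  apply/derivable_mxP => i j; rewrite (ord1 i).
  have [->|->] : j = 0 \/ j = 1.
    by case: j => [[|[|//]] ?]; [left|right]; exact/val_inj.
  - by rewrite c0E; have [] := dML t.
  - by rewrite c1E; have [] := dSL t.
apply/eqP; rewrite eq_le; apply/andP; split; last first.
  apply: le_ereal_inf_tmp => _ [g Hg <-].
  have := fisher_length_ge_potential _ Phi _ _ _ cPhi lPhi Hg.
  by rewrite !laplace_param0 !laplace_param1 !PhiK.
apply: ereal_inf_lbound; exists c.
  split.
  - split.
      apply: continuous_subspaceT => t.
      exact/differentiable_continuous/derivable1_diffP.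
    exists [:: 1]; split; first exact: itv_partition1.
    by move=> i _; exact: derivable_differentiable_on_itv.
  - by move=> t _; rewrite /laplace_domain /= /c laplace_param1.
  - by rewrite /c /L mul0r addr0.
  - by rewrite /c /L mul1r addrC subrK.
rewrite /fisher_length.
have E (t : R) : Num.sqrt
    ((derive1 c t *m fisher_matrix laplace_pdf (c t) *m (derive1 c t)^T) 0 0)
    = `|s2 - s1|.
  rewrite laplace_speed; last by rewrite /c laplace_param1.
  have [_ ->] := derive1_coord _ _ _ _ 0 (dc t).
  have [_ ->] := derive1_coord _ _ _ _ 1 (dc t).
  rewrite c0E c1E !derive1E; have [_ ->] := dML t; have [_ ->] := dSL t.
  rewrite !exprMn -mulrDl speed -exprMn sqrtr_sqr normrM gtr0_norm//.
  by rewrite /c laplace_param1 mulrC mulrA mulVf ?mul1r// gt_eqF.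
under eq_integral do rewrite E.
have mu01 : lebesgue_measure `[0 : R, 1]%classic = 1%E.
  by rewrite lebesgue_measure_itv /= lte_fin ltr01 -EFinB subr0.
rewrite integral_cst; last exact: measurable_itv.
by rewrite [X in (_ * X)%E]mu01 mule1.
Qed.

(** * Potentials for vertical lines and semicircles *)

Lemma laplace_potential_ln_cvg (R : realType) :
  laplace_potential_cvg R (fun _ v => ln v).
Proof.
move=> F u v a b FF b0 _ vb.
exact: (cvg_comp _ _ vb (continuous_ln b0)).
Qed.

Lemma laplace_potential_ln_lip (R : realType) :
  laplace_potential_lip R (fun _ v => ln v).
Proof.
move=> u v t du dv v0 hu hv.
have hl := is_derive1_ln v0.
exists ((v t)^-1 * dv); first exact: (@is_derive1_comp _ _ v).
rewrite normrM gtr0_norm ?invr_gt0// mulrC; apply: ler_wpM2r.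
  by rewrite invr_ge0 ltW.
by rewrite -sqrtr_sqr ler_wsqrtr// lerDr sqr_ge0.
Qed.

(** The vector [(p, q)] is the Euclidean gradient of [ln (|z - A| / |z - B|)] at [z = (u, v)], with
    [a = u - A] and [b = u - B]. Its squared Fisher norm is at most 1 because [(a^2 + v^2) (b^2 +
    v^2) - v^2 (a - b)^2 = (a b + v^2)^2]. *)
Lemma busemann_gradient_bound (R : realType) (a b v x y : R) : 0 < v ->
  ((a / (a ^+ 2 + v ^+ 2) - b / (b ^+ 2 + v ^+ 2)) * x +
   (v / (a ^+ 2 + v ^+ 2) - v / (b ^+ 2 + v ^+ 2)) * y) ^+ 2 * v ^+ 2
  <= x ^+ 2 + y ^+ 2.
Proof.
move=> v0.
have v2 : 0 < v ^+ 2 by rewrite exprn_gt0.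
have Na : 0 < a ^+ 2 + v ^+ 2 by rewrite ltr_wpDl// sqr_ge0.
have Nb : 0 < b ^+ 2 + v ^+ 2 by rewrite ltr_wpDl// sqr_ge0.
set p := a / _ - _; set q := v / _ - _.
have k : (p ^+ 2 + q ^+ 2) * v ^+ 2 <= 1.
  have -> : (p ^+ 2 + q ^+ 2) * v ^+ 2 =
      (v ^+ 2 * (a - b) ^+ 2) / ((a ^+ 2 + v ^+ 2) * (b ^+ 2 + v ^+ 2)).
    by rewrite /p /q; field; rewrite !gt_eqF.
  rewrite ler_pdivrMr ?mulr_gt0// mul1r.
  have := sqr_ge0 (a * b + v ^+ 2); nra.
(* Cauchy-Schwarz through the identity [(p x + q y)^2 + (p y - q x)^2 = (p^2 + q^2) (x^2 + y^2)]. *)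
have h : 0 <= (p * y - q * x) ^+ 2 * v ^+ 2 by rewrite mulr_ge0 ?sqr_ge0.
have xy : 0 <= x ^+ 2 + y ^+ 2 by rewrite addr_ge0 ?sqr_ge0.
have := ler_wpM2r xy k; rewrite mul1r; apply: le_trans.
by rewrite -subr_ge0; apply: le_trans h _; rewrite le_eqVlt; apply/orP; left;
  apply/eqP; ring.
Qed.

(** The potential is [ln (|z - A| / |z - B|)], half the difference of the Busemann functions
    [ln (|z - A|^2 / v)] and [ln (|z - B|^2 / v)] of the ideal points [A] and [B]. *)
Lemma laplace_potential_busemann_cvg (R : realType) (A B : R) :
  laplace_potential_cvg R (fun u v =>
    ln ((u - A) ^+ 2 + v ^+ 2) / 2 - ln ((u - B) ^+ 2 + v ^+ 2) / 2).
Proof.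
move=> F u v a b FF b0 ua vb.
have H (C : R) : ln ((u t - C) ^+ 2 + v t ^+ 2) / 2 @[t --> F]
    --> ln ((a - C) ^+ 2 + b ^+ 2) / 2.
  have N : 0 < (a - C) ^+ 2 + b ^+ 2 by rewrite ltr_wpDl ?sqr_ge0// exprn_gt0.
  apply: cvgM; last exact: cvg_cst.
  have w : (u t - C) ^+ 2 + v t ^+ 2 @[t --> F] --> (a - C) ^+ 2 + b ^+ 2.
    have uC : u t - C @[t --> F] --> a - C by apply: cvgB => //; exact: cvg_cst.
    by apply: cvgD; rewrite expr2; under eq_fun do rewrite expr2; apply: cvgM.
  exact: (cvg_comp _ _ w (continuous_ln N)).
exact: cvgB.
Qed.

Lemma laplace_potential_busemann_lip (R : realType) (A B : R) :
  laplace_potential_lip R (fun u v =>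
    ln ((u - A) ^+ 2 + v ^+ 2) / 2 - ln ((u - B) ^+ 2 + v ^+ 2) / 2).
Proof.
move=> u v t du dv v0 hu hv.
have N (C : R) : 0 < (u t - C) ^+ 2 + v t ^+ 2.
  by rewrite ltr_wpDl ?sqr_ge0// exprn_gt0.
have H (C : R) : is_derive t 1 (fun t => ln ((u t - C) ^+ 2 + v t ^+ 2) / 2)
    (((u t - C) * du + v t * dv) / ((u t - C) ^+ 2 + v t ^+ 2)).
  have hl := is_derive1_ln (N C).
  have hw : is_derive t 1 (fun t => (u t - C) ^+ 2 + v t ^+ 2)
      (2 * ((u t - C) * du + v t * dv)).
    by apply: is_derive_eq; rewrite /GRing.scale /=; ring.
  have hc : is_derive t 1 (fun t => ln ((u t - C) ^+ 2 + v t ^+ 2))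
      (((u t - C) ^+ 2 + v t ^+ 2)^-1 * (2 * ((u t - C) * du + v t * dv))) :=
    @is_derive1_comp _ _ (fun t => (u t - C) ^+ 2 + v t ^+ 2) _ _ _ hl hw.
  apply: is_derive_eq; rewrite /GRing.scale /=; field.
  by rewrite gt_eqF.
set a := u t - A; set b := u t - B.
exists ((a / (a ^+ 2 + v t ^+ 2) - b / (b ^+ 2 + v t ^+ 2)) * du +
        (v t / (a ^+ 2 + v t ^+ 2) - v t / (b ^+ 2 + v t ^+ 2)) * dv).
  have HA := H A; have HB := H B.
  apply: is_derive_eq.
  have := N A; have := N B; rewrite -/a -/b => NB NA.
  by field; rewrite !gt_eqF.
rewrite ler_pdivlMr// -[leLHS]ger0_norm; last by rewrite mulr_ge0// ltW.
rewrite -sqrtr_sqr ler_wsqrtr// exprMn real_normK ?num_real//.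
exact: busemann_gradient_bound.
Qed.

(** * Semicircular geodesics *)

Section Semicircle.
Context (R : realType) (m r : R).
Hypothesis r0 : 0 < r.

(** The arc-length parametrisation [(m + r tanh s, r / cosh s)] of the semicircle of centre [m] and
    radius [r], written rationally in [e^s] so that identities reduce to field computations. *)
Definition semicircle_mu (s : R) : R :=
  m + r * ((expR s ^+ 2 - 1) / (expR s ^+ 2 + 1)).
Definition semicircle_sigma (s : R) : R :=
  r * (2 * expR s / (expR s ^+ 2 + 1)).

Let N_gt0 (s : R) : 0 < expR s ^+ 2 + 1.
Proof. by rewrite ltr_pwDl// exprn_gt0// expR_gt0. Qed.

Let N_neq0 (s : R) : expR s ^+ 2 + 1 != 0.
Proof. by rewrite gt_eqF. Qed.

Let dN (s : R) : is_derive s 1 (fun s : R => (expR s ^+ 2 + 1)^-1)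
  (- (2 * expR s ^+ 2 / (expR s ^+ 2 + 1) ^+ 2)).
Proof.
have hw : is_derive s 1 (fun s : R => expR s ^+ 2 + 1) (2 * expR s ^+ 2).
  by apply: is_derive_eq; rewrite /GRing.scale /=; ring.
have hi : is_derive s 1 (fun s : R => (expR s ^+ 2 + 1)^-1)
    (- (expR s ^+ 2 + 1) ^- 2 *: (2 * expR s ^+ 2)) by exact: is_deriveV.
by apply: is_derive_eq; rewrite /GRing.scale /=; have hN := N_neq0 s; field.
Qed.

Lemma is_derive_semicircle_mu (s : R) : is_derive s 1 semicircle_mu
  (r * (4 * expR s ^+ 2 / (expR s ^+ 2 + 1) ^+ 2)).
Proof.
have hN := N_neq0 s; have he := is_derive_expR s; have hi := dN s.
by apply: is_derive_eq; rewrite /GRing.scale /=; field.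
Qed.

Lemma is_derive_semicircle_sigma (s : R) : is_derive s 1 semicircle_sigma
  (r * (2 * expR s * (1 - expR s ^+ 2) / (expR s ^+ 2 + 1) ^+ 2)).
Proof.
have hN := N_neq0 s; have he := is_derive_expR s; have hi := dN s.
by apply: is_derive_eq; rewrite /GRing.scale /=; field.
Qed.

Lemma semicircle_distance (s1 s2 : R) :
  fisher_rao_distance laplace_pdf laplace_domain
    (laplace_param (semicircle_mu s1) (semicircle_sigma s1))
    (laplace_param (semicircle_mu s2) (semicircle_sigma s2))
  = (`|s2 - s1|)%:E.
Proof.
apply: (fisher_rao_distance_geodesic _ (fun u v =>
    ln ((u - (m - r)) ^+ 2 + v ^+ 2) / 2 - ln ((u - (m + r)) ^+ 2 + v ^+ 2) / 2)
  semicircle_mu semicircle_sigma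
  (fun s => r * (4 * expR s ^+ 2 / (expR s ^+ 2 + 1) ^+ 2))
  (fun s => r * (2 * expR s * (1 - expR s ^+ 2) / (expR s ^+ 2 + 1) ^+ 2))).
- exact: laplace_potential_busemann_cvg.
- exact: laplace_potential_busemann_lip.
- exact: is_derive_semicircle_mu.
- exact: is_derive_semicircle_sigma.
- by move=> s; rewrite mulr_gt0// divr_gt0// mulr_gt0// expR_gt0.
- by move=> s; have hN := N_neq0 s; rewrite /semicircle_sigma; field.
- move=> s; have := N_neq0 s; rewrite /semicircle_sigma /semicircle_mu => hN.
  set Na := (X in ln X / 2 - _); set Nb := (X in _ - ln X / 2).
  have Nb0 : 0 < Nb.
    rewrite ltr_wpDl ?sqr_ge0// exprn_gt0// mulr_gt0// divr_gt0//.
    by rewrite mulr_gt0// expR_gt0.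
  (* Along the semicircle [|z - A|^2 = e^(2 s) |z - B|^2], so the potential is exactly [s]. *)
  have -> : Na = expR s ^+ 2 * Nb by rewrite /Na /Nb; field.
  rewrite lnM ?posrE ?exprn_gt0 ?expR_gt0// lnXn ?expR_gt0// expRK -mulr_natr.
  by field.
Qed.

Lemma semicircle_ratio (s1 s2 : R) :
  ((semicircle_mu s1 - semicircle_mu s2) ^+ 2 +
   (semicircle_sigma s1 - semicircle_sigma s2) ^+ 2) /
  ((semicircle_mu s1 - semicircle_mu s2) ^+ 2 +
   (semicircle_sigma s1 + semicircle_sigma s2) ^+ 2)
  = ((expR s2 - expR s1) / (expR s2 + expR s1)) ^+ 2.
Proof.
rewrite /semicircle_mu /semicircle_sigma.
have := N_gt0 s1; have := N_gt0 s2; have := expR_gt0 s1; have := expR_gt0 s2.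
move: (expR s1) (expR s2) => x y y0 x0 Ny Nx.
(* The common factor of numerator and denominator, which become [K (y - x)^2] and [K (y + x)^2]. *)
pose K := r ^+ 2 * 4 / ((x ^+ 2 + 1) * (y ^+ 2 + 1)).
have K0 : K != 0.
  by rewrite gt_eqF// divr_gt0// mulr_gt0// exprn_gt0.
set mu1 := m + _; set mu2 := m + _; set g1 := r * _; set g2 := r * _.
have -> : (mu1 - mu2) ^+ 2 + (g1 - g2) ^+ 2 = K * (y - x) ^+ 2.
  by rewrite /mu1 /mu2 /g1 /g2 /K; field; rewrite !gt_eqF.
have -> : (mu1 - mu2) ^+ 2 + (g1 + g2) ^+ 2 = K * (y + x) ^+ 2.
  by rewrite /mu1 /mu2 /g1 /g2 /K; field; rewrite !gt_eqF.
by field; rewrite K0 gt_eqF// addr_gt0.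
Qed.

Lemma semicircle_point (mu sigma : R) : 0 < sigma ->
  (mu - m) ^+ 2 + sigma ^+ 2 = r ^+ 2 ->
  exists s, semicircle_mu s = mu /\ semicircle_sigma s = sigma.
Proof.
move=> sigma0 circ.
have fact : (r - (mu - m)) * (mu - m + r) = sigma ^+ 2.
  by rewrite -[RHS](addKr ((mu - m) ^+ 2)) circ; ring.
have fact0 : 0 < (r - (mu - m)) * (mu - m + r) by rewrite fact exprn_gt0.
(* The two factors have a positive product and sum [2 r > 0], hence both are positive. *)
have h : 0 < r - (mu - m).
  rewrite ltNge; apply/negP => h.
  suff : (r - (mu - m)) * (mu - m + r) <= 0 by rewrite leNgt fact0.
  by apply: mulr_le0_ge0 => //; move: r0 h; lra.
have pos : 0 < mu - m + r by rewrite pmulr_rgt0 in fact0.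
(* The parameter is forced by [(1 + tanh s) cosh s = e^s]. *)
exists (ln ((mu - m + r) / sigma)).
rewrite /semicircle_mu /semicircle_sigma lnK; last by rewrite posrE divr_gt0.
have -> : ((mu - m + r) / sigma) ^+ 2 = (r + (mu - m)) / (r - (mu - m)).
  by rewrite expr_div_n -fact; field; rewrite !gt_eqF.
have -> : (r + (mu - m)) / (r - (mu - m)) + 1 = 2 * r / (r - (mu - m)).
  by field; rewrite gt_eqF.
split; first by field; rewrite !gt_eqF.
rewrite (_ : r * _ = (r - (mu - m)) * (mu - m + r) / sigma); last first.
  by field; rewrite !gt_eqF.
by rewrite fact; field; rewrite gt_eqF.
Qed.

End Semicircle.

(** * Vertical geodesics and the closed formula *)

Lemma vertical_distance (R : realType) (mu s1 s2 : R) :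
  fisher_rao_distance laplace_pdf laplace_domain
    (laplace_param mu (expR s1)) (laplace_param mu (expR s2))
  = (`|s2 - s1|)%:E.
Proof.
apply: (fisher_rao_distance_geodesic _ (fun _ v => ln v) (fun=> mu) expR (fun=> 0) expR).
- exact: laplace_potential_ln_cvg.
- exact: laplace_potential_ln_lip.
- exact: expR_gt0.
- by move=> s; rewrite expr0n add0r.
- exact: expRK.
Qed.

(** For [s1 <= s2] the quotient is [tanh ((s2 - s1) / 2)]; the square makes the expression symmetric
    in [s1] and [s2]. *)
Lemma arctanh_log_ratio (R : realType) (s1 s2 : R) :
  2 * arctanh (Num.sqrt (((expR s2 - expR s1) / (expR s2 + expR s1)) ^+ 2))
  = `|s2 - s1|.
Proof.
wlog s12 : s1 s2 / s1 <= s2.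
  move=> H; have [s12|/ltW s21] := leP s1 s2; first exact: H.
  rewrite distrC -(H _ _ s21); congr (2 * arctanh (Num.sqrt _)).
  by rewrite -[expR s2 - _]opprB mulNr sqrrN [expR s2 + _]addrC.
have e0 : 0 < expR s2 + expR s1 by rewrite addr_gt0 ?expR_gt0.
rewrite sqrtr_sqr ger0_norm; last by rewrite divr_ge0 ?subr_ge0 ?ler_expR// ltW.
rewrite ger0_norm ?subr_ge0//.
have -> : (expR s2 - expR s1) / (expR s2 + expR s1) = tanh ((s2 - s1) / 2).
  rewrite /tanh expRN.
  have -> : expR s2 = expR s1 * expR ((s2 - s1) / 2) ^+ 2.
    by rewrite expr2 -!expRD; congr expR; field.
  have := expR_gt0 s1; have := expR_gt0 ((s2 - s1) / 2).
  move: (expR s1) (expR _) => x y y0 x0.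
  by field; rewrite !gt_eqF//; rewrite ?addr_gt0 ?mulr_gt0 ?exprn_gt0.
by rewrite tanhK mulrC divfK.
Qed.

Theorem mainTheorem4 (R : realType) :
  (forall mu sigma : R, 0 < sigma ->
     [/\ is_density (laplace_pdf (laplace_param mu sigma)),
         fisher_matrix_exists laplace_pdf (laplace_param mu sigma) &
         fisher_matrix laplace_pdf (laplace_param mu sigma)
           = (1 / sigma ^+ 2)%:M]) /\
  (forall mu1 sigma1 mu2 sigma2 : R, 0 < sigma1 -> 0 < sigma2 ->
     fisher_rao_distance laplace_pdf laplace_domain
       (laplace_param mu1 sigma1) (laplace_param mu2 sigma2)
     = (2 * arctanh (Num.sqrt (((mu1 - mu2) ^+ 2 + (sigma1 - sigma2) ^+ 2)
                             / ((mu1 - mu2) ^+ 2 + (sigma1 + sigma2) ^+ 2))))%:E).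
Proof.
split=> [mu sigma s0|mu1 sigma1 mu2 sigma2 s10 s20].
  have x0 : 0 < laplace_param mu sigma 0 1 by rewrite laplace_param1.
  split; [exact: laplace_is_density|exact: laplace_fisher_matrix_exists|].
  by rewrite laplace_fisher_matrixE// laplace_param1.
have [<-|mu12] := eqVneq mu1 mu2.
  (* On a vertical line the arc-length parameter is [ln sigma]. *)
  rewrite -[sigma1]lnK ?posrE// -[sigma2]lnK ?posrE// vertical_distance.
  rewrite subrr expr0n !add0r -expr_div_n -arctanh_log_ratio.
  by rewrite -[expR (ln sigma2) - _]opprB mulNr sqrrN [expR (ln sigma2) + _]addrC.
(* The point of the real axis at equal Euclidean distance from the two given points, hence the
   centre of the semicircle through them. *)
pose m := (mu1 + mu2) / 2 + (sigma2 ^+ 2 - sigma1 ^+ 2) / (2 * (mu2 - mu1)).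
pose r := Num.sqrt ((mu1 - m) ^+ 2 + sigma1 ^+ 2).
have p0 : 0 < (mu1 - m) ^+ 2 + sigma1 ^+ 2.
  by rewrite ltr_wpDl ?sqr_ge0// exprn_gt0.
have r0 : 0 < r by rewrite sqrtr_gt0.
have r1 : (mu1 - m) ^+ 2 + sigma1 ^+ 2 = r ^+ 2 by rewrite sqr_sqrtr// ltW.
have r2 : (mu2 - m) ^+ 2 + sigma2 ^+ 2 = r ^+ 2.
  rewrite -r1 /m; field; rewrite subr_eq0 eq_sym; exact: mu12.
have [s1 [<- <-]] := semicircle_point _ _ _ r0 _ _ s10 r1.
have [s2 [<- <-]] := semicircle_point _ _ _ r0 _ _ s20 r2.
by rewrite semicircle_distance// semicircle_ratio// arctanh_log_ratio.
Qed.
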